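(* For all positive integers $n$ and all $\varepsilon\in(0,1/2)$, $$\mathsf{Q}^{\mathrm{pure},\rightarrow}_{\varepsilon}(\mathsf{EQ}_n)\le\log\left(\frac{n}{\varepsilon}\right)+4.$$
   Context: All logarithms are base 2. $\mathsf{EQ}_n:\{0,1\}^n\times\{0,1\}^n\to\{0,1\}$ is the Equality function: $\mathsf{EQ}_n(x,y)=1$ iff $x=y$. A one-way pure-state quantum protocol of cost $\log d$ consists of a unit vector $|\phi_x\rangle\in\mathbb{C}^d$ for each $x\in\{0,1\}^n$ (the message Alice sends on input $x$) and an orthogonal projector $P_y$ on $\mathbb{C}^d$ for each $y\in\{0,1\}^n$ (Bob on input $y$ measures with $\{P_y,I-P_y\}$ and outputs 1 on the first outcome, 0 otherwise). Thus the probability of output 1 on $(x,y)$ is $\|P_y|\phi_x\rangle\|^2$. There is no shared randomness or entanglement. The protocol computes $F:\{0,1\}^n\times\{0,1\}^n\to\{0,1\}$ with error $\varepsilon$ if for every $(x,y)$ the output differs from $F(x,y)$ with probability at most $\varepsilon$. $\mathsf{Q}^{\mathrm{pure},\rightarrow}_{\varepsilon}(F)$ is the minimum of $\log d$ (not rounded to an integer) over all such protocols computing $F$ with error $\varepsilon$. *)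

(* Defs.v *)
From mathcomp Require Import all_boot all_order all_algebra.
From mathcomp Require Import complex.
From mathcomp Require Import all_classical all_reals all_analysis.

Set Implicit Arguments.
Unset Strict Implicit.
Unset Printing Implicit Defensive.

Import Order.TTheory GRing.Theory Num.Theory.
Local Open Scope ring_scope.
Local Open Scope classical_set_scope.
Local Open Scope sesquilinear_scope.

Definition log2 (R : realType) (a : R) : R := ln a / ln 2.

(* The norm `|z| of z : R[i] is itself R[i]-valued; ComplexField.Normc.normc is
   the same modulus as an element of R, in which probabilities live. *)
Definition sqnorm (R : realType) (d : nat) (v : 'cV[R[i]]_d) : R :=
  \sum_(i < d) ComplexField.Normc.normc (v i 0) ^+ 2.

Definition orthogonal_projector (R : realType) (d : nat) (P : 'M[R[i]]_d) :
  Prop := P *m P = P /\ P ^t* = P.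

Record pure_oneway_protocol (R : realType) (n d : nat) := PureOnewayProtocol {
  message : n.-tuple bool -> 'cV[R[i]]_d;
  bob_proj : n.-tuple bool -> 'M[R[i]]_d;
  message_unit : forall x, sqnorm (message x) = 1;
  bob_proj_orthogonal : forall y, orthogonal_projector (bob_proj y)
}.

Definition output_prob (R : realType) (n d : nat)
    (p : pure_oneway_protocol R n d) (x y : n.-tuple bool) (b : bool) : R :=
  if b then sqnorm (bob_proj p y *m message p x)
  else sqnorm ((1%:M - bob_proj p y) *m message p x).

(* The output is a bit, so it differs from F x y iff it equals ~~ F x y. *)
Definition computes (R : realType) (n d : nat) (p : pure_oneway_protocol R n d)
    (F : n.-tuple bool -> n.-tuple bool -> bool) (eps : R) : Prop :=
  forall x y, output_prob p x y (~~ F x y) <= eps.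

Definition pure_costs (R : realType) (n : nat) (eps : R)
    (F : n.-tuple bool -> n.-tuple bool -> bool) : set \bar R :=
  [set (log2 d%:R)%:E | d in
    [set d : nat | exists p : pure_oneway_protocol R n d, computes p F eps]].

(* The infimum is taken in \bar R so that it would be +oo, and not a junk real,
   if there were no protocol; otherwise it is a minimum (Qpure_min). *)
Definition Qpure (R : realType) (n : nat) (eps : R)
    (F : n.-tuple bool -> n.-tuple bool -> bool) : \bar R :=
  ereal_inf (pure_costs eps F).

Lemma Qpure_min (R : realType) (n : nat) (eps : R)
    (F : n.-tuple bool -> n.-tuple bool -> bool) :
  pure_costs eps F !=set0 -> pure_costs eps F (Qpure eps F).
Proof.
move=> [_ [d0 /= Hd0 _]].
pose S d := `[< exists p : pure_oneway_protocol R n d, computes p F eps >].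
have exS : exists d, S d by exists d0; apply/asboolP.
have [d /asboolP Sd dmin] := ex_minnP exS.
suff -> : Qpure eps F = (log2 d%:R)%:E by exists d.
apply/eqP; rewrite eq_le; apply/andP; split.
  by apply: ereal_inf_lbound; exists d.
apply: le_ereal_inf_tmp => _ [d' /= Hd' <-].
have dd' : (d <= d')%N by apply/dmin/asboolP.
rewrite lee_fin ler_pM2r ?invr_gt0 ?ln_gt0 ?ltr1n//.
case: d dd' {Sd dmin} => [_|d dd'].
  case: d' {Hd'} => [//|d'].
  by rewrite ln0// ln_ge0// ler1n.
by rewrite ler_ln ?posrE ?ltr0n ?ler_nat// (leq_trans _ dd').
Qed.

Definition EQ (n : nat) (x y : n.-tuple bool) : bool := x == y.

(* Main.v *)
(** Alice sends the normalized sign vector [s_x / sqrt d] and Bob projects onto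
    the message of [y], so the output is always right on [x = y], and wrong on
    [x <> y] with probability [(<s_x, s_y> / d)^2].  For
    [d = floor (6 (n + 1) / eps) + 1 <= 16 n / eps], any fewer than [2^n] sign
    vectors admit a further one whose squared correlation with each of them is
    at most [eps]: a Chernoff bound shows that a uniformly random one works
    with positive probability.  Hence [2^n] messages can be chosen greedily. *)
Require Import Defs.
From mathcomp Require Import all_boot all_order all_algebra.
From mathcomp Require Import complex ring lra.
From mathcomp Require Import all_classical all_reals all_analysis.
Import Order.TTheory GRing.Theory Num.Theory.
Local Open Scope ring_scope.

Section SignVectors.
Variables (R : realType) (d : nat).
Implicit Types (s v : {ffun 'I_d -> bool}).

Definition sign_dot s v : R := \sum_i (-1) ^+ s i * (-1) ^+ v i.

Lemma sign_dotC s v : sign_dot s v = sign_dot v s.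
Proof. by apply: eq_bigr => i _; rewrite mulrC. Qed.

Lemma sign_dotxx s : sign_dot s s = d%:R.
Proof.
rewrite /sign_dot (eq_bigr (fun=> 1)).
  by rewrite sumr_const card_ord.
by move=> i _; rewrite -expr2 sqrr_sign.
Qed.

(** The exponential turns the sum over coordinates into a product, and the sum over all [v]
    distributes over it. Each factor is [expR l + expR (- l)], whatever the sign [s i]. *)
Lemma sum_expR_sign_dot (l : R) s :
  \sum_v expR (l * sign_dot s v) = (expR l + expR (- l)) ^+ d.
Proof.
pose F i (b : bool) : R := expR (l * ((-1) ^+ s i * (-1) ^+ b)).
transitivity (\sum_(v : {ffun 'I_d -> bool}) \prod_i F i (v i)).
  by apply: eq_bigr => v _; rewrite mulr_sumr expR_sum.
rewrite -bigA_distr_bigA /=.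
rewrite (eq_bigr (fun=> expR l + expR (- l))).
  by rewrite prodr_const card_ord.
move=> i _; rewrite big_bool /F.
by case: (s i); rewrite /= ?expr1 ?expr0 ?mulrNN ?mulr1 ?mul1r ?mulrN1 // addrC.
Qed.

(** A weak form of [cosh l <= expR (l ^+ 2 / 2)]. From [expR x <= (1 - x)^-1] the left side is at
    most [2 / (1 - l ^+ 2)], and [1 <= (1 - l ^+ 2) * (1 + 3 / 2 * l ^+ 2)] holds exactly when
    [l ^+ 2 <= 1 / 3]. *)
Lemma expRD_expRN_le (l : R) :
  l ^+ 2 <= 1 / 3 -> expR l + expR (- l) <= 2 * expR (3 / 2 * l ^+ 2).
Proof.
move=> l2.
have le_inv (x : R) : x < 1 -> expR x <= (1 - x)^-1.
  move=> x1; rewrite -[expR x]invrK -expRN lef_pV2 ?posrE ?expR_gt0 ?subr_gt0//.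
  exact: expR_ge1Dx.
have l1 : l < 1 by nra.
have l1' : - l < 1 by nra.
apply: le_trans (lerD (le_inv _ l1) (le_inv _ l1')) _.
have -> : (1 - l)^-1 + (1 - - l)^-1 = 2 * (1 - l ^+ 2)^-1.
  by field; apply/and3P; split; apply: lt0r_neq0; nra.
rewrite ler_pM2l//; apply: le_trans (expR_ge1Dx _).
rewrite -div1r ler_pdivrMr; nra.
Qed.

(* Chernoff: average over [v] the sum [W v] over the [k] centers of the
   exponentials of [+- l <f i, v>], for [l = sqrt eps / 3], which minimizes
   [3 / 2 * l ^+ 2 - l * sqrt eps]. *)
Lemma exists_far_sign_vector (eps : R) (k : nat)
    (f : nat -> {ffun 'I_d -> bool}) :
  0 < eps < 1 -> (2 * k)%:R < expR (eps * d%:R / 6) ->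
  exists v, forall i, (i < k)%N -> sign_dot (f i) v ^+ 2 <= eps * d%:R ^+ 2.
Proof.
move=> /andP[eps0 eps1] kd; apply: contrapT => noex.
pose q := Num.sqrt eps; have q2 : q ^+ 2 = eps by rewrite sqr_sqrtr ?ltW.
have q0 : 0 < q by rewrite sqrtr_gt0.
pose l := q / 3.
pose W v : R := \sum_(i < k) (expR (l * sign_dot (f i) v) +
                             expR (- l * sign_dot (f i) v)).
(* As no [v] is good, some center has correlation above [q * d] in absolute value. One of its two
   exponentials, according to the sign, already gives the bound. *)
have Wge v : expR (l * (q * d%:R)) <= W v.
  have [i ik] : exists2 i, (i < k)%N & eps * d%:R ^+ 2 < sign_dot (f i) v ^+ 2.
    apply: contrapT => nob; apply: noex; exists v => i ik.
    by rewrite leNgt; apply/negP => H; apply: nob; exists i.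
  move=> big; rewrite /W (bigD1 (Ordinal ik)) //=.
  apply: ler_wpDr; first by apply: sumr_ge0 => j _; rewrite addr_ge0 ?expR_ge0.
  set x := sign_dot _ _ in big *.
  have : q * d%:R < `|x|.
    rewrite -(@ltr_pXn2r _ 2) ?nnegrE ?mulr_ge0 ?ler0n ?(ltW q0)// exprMn q2.
    by rewrite real_normK ?num_real.
  rewrite ltr_normr => /orP[] qx.
    by apply: ler_wpDr; rewrite ?expR_ge0// ler_expR ler_pM2l ?ltW// divr_gt0.
  apply: ler_wpDl; rewrite ?expR_ge0// ler_expR mulNr -mulrN ler_pM2l ?ltW//.
  by rewrite divr_gt0.
have sumW : \sum_v W v = (2 * k)%:R * (expR l + expR (- l)) ^+ d.
  rewrite /W exchange_big /=.
  rewrite (eq_bigr (fun=> (expR l + expR (- l)) ^+ d *+ 2)); last first.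
    move=> i _; rewrite big_split /= !sum_expR_sign_dot opprK.
    by rewrite [expR (- l) + _]addrC mulr2n.
  by rewrite sumr_const card_ord -mulrnA mulr_natl.
(* Adding up [Wge] over all [2 ^ d] sign vectors contradicts the upper bound that follows from
   [sumW]. *)
have : (2 ^ d)%:R * expR (l * (q * d%:R)) <= \sum_v W v.
  rewrite mulr_natl -[X in (X ^ d)%N]card_bool -[in X in (_ ^ X)%N](card_ord d).
  by rewrite -card_ffun -sumr_const; apply: ler_sum.
rewrite sumW; apply/negP; rewrite -ltNge.
have Mle : (expR l + expR (- l)) ^+ d <= (2 ^ d)%:R * expR (eps / 6 * d%:R).
  rewrite mulrC expRM_natr natrX -exprMn lerXn2r ?nnegrE ?addr_ge0 ?mulr_ge0 ?expR_ge0//.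
  have l2 : l ^+ 2 = eps / 9 by rewrite /l expr_div_n q2; field.
  rewrite mulrC; have -> : eps / 6 = 3 / 2 * l ^+ 2 by rewrite l2; field.
  by apply: expRD_expRN_le; rewrite l2; lra.
apply: (le_lt_trans (ler_wpM2l _ Mle)) => //.
rewrite mulrCA ltr_pM2l ?ltr0n ?expn_gt0//.
(* The exponent is [eps * d / 3]: one half cancels the factor from [Mle], the other exceeds [2 * k]
   by hypothesis. *)
have -> : l * (q * d%:R) = eps * d%:R / 6 + eps / 6 * d%:R.
  by rewrite -q2 /l; field.
by rewrite expRD ltr_pM2r ?expR_gt0.
Qed.

(** Greedy choice by induction on [N]. Indexing by [nat] lets the family be extended by changing its
    value at [N] alone. *)
Lemma exists_almost_orthogonal_signs (eps : R) (N : nat) :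
  0 < eps < 1 -> (2 * N)%:R <= expR (eps * d%:R / 6) ->
  exists f : nat -> {ffun 'I_d -> bool}, forall i j, (i < N)%N -> (j < N)%N ->
    i != j -> sign_dot (f i) (f j) ^+ 2 <= eps * d%:R ^+ 2.
Proof.
move=> eps01; elim: N => [|N IH] Nd; first by exists (fun=> [ffun=> false]).
have ltNd : (2 * N)%:R < expR (eps * d%:R / 6).
  by apply: lt_le_trans Nd; rewrite ltr_nat ltn_pmul2l.
have [f Hf] := IH (ltW ltNd).
have [v Hv] := exists_far_sign_vector _ _ f eps01 ltNd.
exists (fun i => if i == N then v else f i) => i j.
rewrite !ltnS (leq_eqVlt i) (leq_eqVlt j).
case: eqVneq => [->|iN]; case: eqVneq => [->|jN] //=.
- by move=> _ jN' _; rewrite sign_dotC Hv.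
- by move=> iN' _ _; rewrite Hv.
- exact: Hf.
Qed.

End SignVectors.

Section RealProtocol.
Variables (R : realType) (n d : nat).
Local Notation toC := (real_complex R).
Local Open Scope sesquilinear_scope.

Lemma sqnorm_map_real (v : 'cV[R]_d) :
  sqnorm (map_mx toC v) = \sum_i v i 0 ^+ 2.
Proof.
apply: eq_bigr => i _; rewrite mxE /= expr0n addr0 sqr_sqrtr//.
exact: sqr_ge0.
Qed.

Variable u : n.-tuple bool -> 'cV[R]_d.
Hypothesis u_unit : forall x, (u x)^T *m u x = 1%:M.

Lemma real_message_unit x : sqnorm (map_mx toC (u x)) = 1.
Proof.
rewrite sqnorm_map_real; have /matrixP/(_ 0 0) := u_unit x.
by rewrite !mxE eqxx mulr1n => <-; apply: eq_bigr => i _; rewrite mxE expr2.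
Qed.

(** Idempotent because [u y] is a unit vector, Hermitian because the matrix is real and
    symmetric. *)
Lemma rank_one_projector y :
  orthogonal_projector (map_mx toC (u y *m (u y)^T)).
Proof.
split; first by rewrite -map_mxM -!mulmxA [(u y)^T *m _]mulmxA u_unit mul1mx.
apply/matrixP => i j; rewrite !mxE.
have -> : \sum_k u y j k * (u y)^T k i = \sum_k u y i k * (u y)^T k j.
  by apply: eq_bigr => k _; rewrite !mxE !ord1 mulrC.
exact: conjc_real.
Qed.

Definition fingerprint_protocol : pure_oneway_protocol R n d :=
  PureOnewayProtocol real_message_unit rank_one_projector.

Lemma fingerprint_computes_EQ (eps : R) : 0 <= eps ->
  (forall x y, x != y -> (\sum_i u y i 0 * u x i 0) ^+ 2 <= eps) ->
  computes fingerprint_protocol (@EQ n) eps.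
Proof.
move=> eps0 Hu x y; rewrite /output_prob /EQ /=.
case: eqVneq => [<-|xy] /=.
  rewrite -(map_mx1 toC) -map_mxB -map_mxM mulmxBl mul1mx -mulmxA u_unit mulmx1.
  by rewrite subrr sqnorm_map_real big1// => i _; rewrite mxE expr0n.
(* The 1 by 1 matrix [(u y)^T *m u x] is a scalar [c], so the projected message is [c] times the
   unit vector [u y] and has squared norm [c ^+ 2]. *)
rewrite -map_mxM -mulmxA [_^T *m _]mx11_scalar mul_mx_scalar sqnorm_map_real.
have := Hu _ _ xy; set c := (_ *m _) 0 0.
have -> : \sum_i u y i 0 * u x i 0 = c.
  by rewrite /c mxE; apply: eq_bigr => i _; rewrite mxE.
move=> ceps.
under eq_bigr do rewrite mxE exprMn.
by rewrite -mulr_sumr -sqnorm_map_real real_message_unit mulr1.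
Qed.

End RealProtocol.

Lemma EQ_protocol (R : realType) (n d : nat) (eps : R) :
  (0 < d)%N -> 0 < eps < 1 -> n.+1%:R <= eps * d%:R / 6 ->
  exists p : pure_oneway_protocol R n d, computes p (@EQ n) eps.
Proof.
move=> d0 eps01 nd.
(* The left side is [2 ^ n.+1], at most [expR n.+1] since [2 <= expR 1]. *)
have N2 : (2 * #|{: n.-tuple bool}|)%:R <= expR (eps * d%:R / 6) :> R.
  rewrite card_tuple card_bool -expnS natrX.
  apply: (@le_trans _ _ (expR 1 ^+ n.+1)).
    by rewrite lerXn2r ?nnegrE ?expR_ge0//; apply: le_trans (expR_ge1Dx _); lra.
  by rewrite -expRM_natl mulr1 ler_expR.
have [f Hf] := exists_almost_orthogonal_signs R d eps _ eps01 N2.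
pose s (x : n.-tuple bool) := f (enum_rank x).
pose r : R := Num.sqrt d%:R.
have r2 : r ^+ 2 = d%:R by rewrite sqr_sqrtr.
have r0 : r != 0 by rewrite gt_eqF// sqrtr_gt0 ltr0n.
pose u x : 'cV[R]_d := \col_i ((-1) ^+ s x i / r).
have udot x y : \sum_i u y i 0 * u x i 0 = sign_dot R d (s y) (s x) / d%:R.
  rewrite /sign_dot mulr_suml; apply: eq_bigr => i _; rewrite !mxE -r2.
  by field.
have u_unit x : (u x)^T *m u x = 1%:M.
  apply/matrixP => i j; rewrite !ord1 mxE.
  under eq_bigr do rewrite [_^T _ _]mxE.
  by rewrite udot sign_dotxx divff ?mxE// pnatr_eq0 -lt0n.
exists (fingerprint_protocol _ _ _ u u_unit); apply: fingerprint_computes_EQ.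
  by case/andP: eps01 => /ltW.
move=> x y xy; rewrite udot expr_div_n ler_pdivrMr ?exprn_gt0 ?ltr0n//.
apply: Hf; rewrite ?ltn_ord//.
by apply: contra_neq xy => /ord_inj/enum_rank_inj.
Qed.

Theorem theorem1p9 (R : realType) (n : nat) (eps : R)
    (n_gt0 : (0 < n)%N) (eps_gt0 : 0 < eps) (eps_lt_half : eps < 1 / 2) :
  (Qpure eps (@EQ n) <= (log2 (n%:R / eps) + 4)%:E)%E.
Proof.
have n1 : 1 <= n%:R :> R by rewrite ler1n.
(* The dimension has to be at least [t] for [EQ_protocol] to apply; the successor of the truncation
   exceeds [t] and is at most [t + 1]. *)
pose t : R := 6 * n.+1%:R / eps.
have t0 : 0 <= t by rewrite divr_ge0 ?mulr_ge0 ?ltW.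
have := truncnS_gt t; set d := (Num.truncn t).+1 => tf.
have eps01 : 0 < eps < 1 by apply/andP; split; lra.
have nd : n.+1%:R <= eps * d%:R / 6.
  move: tf; rewrite /t ltr_pdivrMr// => tf; lra.
have [p Hp] := EQ_protocol R n d eps isT eps01 nd.
apply: (@le_trans _ _ (log2 d%:R)%:E).
  by apply: ereal_inf_lbound; exists d => //; exists p.
have ln2 : 0 < ln 2 :> R by rewrite ln_gt0 // ltr1n.
rewrite lee_fin /log2 -[4](mulfK (lt0r_neq0 ln2)) -mulrDl ler_pM2r ?invr_gt0//.
have -> : 4 * ln 2 = ln (2 ^+ 4) :> R by rewrite lnXn// mulr_natl.
have ne0 : 0 < n%:R / eps by rewrite divr_gt0//; lra.
rewrite -lnM ?posrE// ler_ln ?posrE ?mulr_gt0 ?invr_gt0 ?ltr0n//.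
(* It remains to bound [d] by [16 * (n / eps)]. In [t + 1 = 6 * (n / eps) + 6 / eps + 1] the middle
   term is at most [6 * (n / eps)], and [1] is at most half of [n / eps]. *)
apply: (@le_trans _ _ (t + 1)); first by rewrite -natr1 lerD2r truncn_le.
have : 2 * n%:R <= n%:R / eps by rewrite ler_pdivlMr//; nra.
have -> : t = 6 * (n%:R / eps) + 6 / eps.
  by rewrite /t -natr1; field; exact: lt0r_neq0.
have : eps^-1 <= n%:R / eps by rewrite ler_peMl// invr_ge0 ltW.
have -> : 2 ^+ 4 = 16 :> R by rewrite -natrX.
lra.
Qed.
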